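(* Let $\xi$ be a convergence on a set $X$ all of whose singletons are cover-Lindelöf (in particular, this is the case if the pseudopaving number satisfies $\mathsf{pp}(\xi)\leq\omega$). Then $\mathrm{S}\xi=\mathrm{S}_1\xi$. In particular, every pseudotopology of countable pseudopaving number is a paratopology.
   Context: Filters on $X$ are families of nonempty subsets closed under finite intersections and supersets, ordered by inclusion ($\leq$). Two families of sets mesh, $\mathcal{A}\#\mathcal{B}$, if $A\cap B\neq\emptyset$ for all $A\in\mathcal{A},B\in\mathcal{B}$. A filter is countably based if it has a countable filter-base. A convergence $\xi$ on $X$ is a relation between points and filters, written $x\in\lim_\xi\mathcal{F}$, such that $x\in\lim_\xi\{x\}^{\uparrow}$ for all $x$ (where $\{x\}^\uparrow$ is the principal ultrafilter of $x$), and $\mathcal{F}\subset\mathcal{G}$ implies $\lim_\xi\mathcal{F}\subset\lim_\xi\mathcal{G}$. The adherence of a filter $\mathcal{H}$ is $\mathrm{adh}_\xi\mathcal{H}=\bigcup_{\mathcal{F}\#\mathcal{H}}\lim_\xi\mathcal{F}$ (union over filters $\mathcal{F}$ on $X$). $\mathrm{S}\xi$ (resp. $\mathrm{S}_1\xi$) is the convergence in which the limit of a filter $\mathcal{F}$ is $\bigcap\{\mathrm{adh}_\xi\mathcal{D}:\mathcal{D}\#\mathcal{F}\}$, where $\mathcal{D}$ ranges over all filters (resp. all countably based filters) on $X$. $\xi$ is a pseudotopology if $\xi=\mathrm{S}\xi$ and a paratopology if $\xi=\mathrm{S}_1\xi$. A singleton $\{x\}$ is cover-Lindelöf (for $\xi$)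 if for every filter $\mathcal{G}$ on $X$ with $x\notin\mathrm{adh}_\xi\mathcal{G}$ there is a countably based filter $\mathcal{D}\leq\mathcal{G}$ with $x\notin\mathrm{adh}_\xi\mathcal{D}$. A pseudopavement at $x$ is a family $\mathbb{D}$ of filters, each converging to $x$, such that every ultrafilter converging to $x$ contains some $\mathcal{D}\in\mathbb{D}$. $\mathsf{pp}(\xi,x)$ is the least cardinality of a pseudopavement at $x$, and the pseudopaving number is $\mathsf{pp}(\xi)=\sup_{x\in X}\mathsf{pp}(\xi,x)$; it is countable if $\mathsf{pp}(\xi)\leq\omega$. *)

(* Defs.v *)
From HB Require Import structures.
From mathcomp Require Import all_boot.
From mathcomp Require Import boolp classical_sets functions cardinality filter.

Set Implicit Arguments.
Unset Strict Implicit.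
Unset Printing Implicit Defensive.

Local Open Scope classical_set_scope.
Local Open Scope card_scope.

(* [pfilter_on X] is the type of filters of nonempty sets; the library's
   [filter_on X] also contains the degenerate filter. *)
Record convergence (X : Type) := Convergence {
  clim :> pfilter_on X -> set X;
  clim_principal : forall x,
    clim (PFilterPack (principal_filter x) (principal_filter_proper x)) x;
  clim_mono : forall F G : pfilter_on X, F `<=` G -> clim F `<=` clim G
}.

Definition adh (X : Type) (xi : convergence X) (H : pfilter_on X) : set X :=
  \bigcup_(F in [set F : pfilter_on X | F `#` H]) xi F.

Definition countably_based (X : Type) (F : pfilter_on X) : Prop :=
  exists B : set_system X, countable B /\ filter_from B id = F.

Section Modification.
Variables (X : Type) (J : set (pfilter_on X)) (xi : convergence X).

Definition modif_lim (F : pfilter_on X) : set X :=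
  \bigcap_(D in [set D : pfilter_on X | J D /\ D `#` F]) adh xi D.

Lemma modif_principal (x : X) :
  modif_lim (PFilterPack (principal_filter x) (principal_filter_proper x)) x.
Proof.
move=> D [_ Dx].
exists (PFilterPack (principal_filter x) (principal_filter_proper x)).
  by rewrite /= meetsC.
exact: clim_principal.
Qed.

Lemma modif_mono (F G : pfilter_on X) :
  F `<=` G -> modif_lim F `<=` modif_lim G.
Proof.
move=> FG x xF D [JD DG]; apply: xF; split=> // A B DA FB.
exact: DG DA (FG _ FB).
Qed.

Definition modif : convergence X := Convergence modif_principal modif_mono.

End Modification.

Definition S_conv (X : Type) : convergence X -> convergence X := modif setT.

Definition S1_conv (X : Type) : convergence X -> convergence X :=
  modif (@countably_based X).

Definition pseudotopology (X : Type) (xi : convergence X) : Prop := xi = S_conv xi.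

Definition paratopology (X : Type) (xi : convergence X) : Prop := xi = S1_conv xi.

Definition cover_Lindelof (X : Type) (xi : convergence X) (x : X) : Prop :=
  forall G : pfilter_on X, ~ adh xi G x ->
    exists D : pfilter_on X,
      [/\ countably_based D, D `<=` G & ~ adh xi D x].

Definition pseudopavement (X : Type) (xi : convergence X) (x : X)
    (DD : set (pfilter_on X)) : Prop :=
  (forall D, DD D -> xi D x) /\
  (forall U : pfilter_on X, UltraFilter U -> xi U x ->
    exists2 D, DD D & D `<=` U).

(* Cardinals are represented by sets compared with [#<=], as the library has no
   type of cardinals.  [least_card_ex] is the well-foundedness of cardinals: it
   makes "the least cardinality of a set in [P]" meaningful. *)
Lemma least_card_ex (T : Type) (P : set (set T)) : P !=set0 ->
  exists A, P A /\ forall B, P B -> A #<= B.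
Proof.
case=> A0 PA0.
have [[t0 _]|T0] := pselect (exists t : T, True); last first.
  exists A0; split=> // B _.
  have -> : A0 = set0 by apply/seteqP; split=> // t _; apply: T0; exists t.
  exact: card_ge0.
(* a maximal set of choice functions of [P], pairwise distinct everywhere *)
pose Q (G : set (set T -> T)) :=
  (forall f, G f -> forall A, P A -> A (f A)) /\
  (forall f g, G f -> G g -> forall A, P A -> f A = g A -> f = g).
have [|G [[Gsel Ginj] Gmax]] := @Zorn_bigcup _ Q.
  move=> F FQ Ftot; split.
    by move=> f [G FG Gf]; exact: (FQ _ FG).1.
  move=> f g [G FG Gf] [H FH Hg]; have [GH|HG] := Ftot _ _ FG FH.
    by apply: (FQ _ FH).2 => //; exact: GH.
  by apply: (FQ _ FG).2 => //; exact: HG.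
have [[A [PA AG]]|noA] := pselect
    (exists A, P A /\ forall a, A a -> exists2 f, G f & f A = a).
  exists A; split=> // B PB.
  pose pT : pointedType := HB.pack T (gen_eqMixin T) (gen_choiceMixin T)
    (isPointed.Build T t0).
  have /choice[h hP] (a : T) : exists f, A a -> G f /\ f A = a.
    have [/AG[f Gf fa]|nAa] := pselect (A a); first by exists f.
    by exists (fun=> t0).
  have : @card_le T pT A B; last by [].
  apply/pcard_leP/injfunPex; exists (fun a => h a B).
    by move=> a /hP[Gh _]; exact: (Gsel _ Gh _ PB).
  move=> a b /set_mem /hP[Ga ha] /set_mem /hP[Gb hb] hab.
  by rewrite -ha -hb (Ginj _ _ Ga Gb _ PB hab).
have /choice[k kP] (A : set T) :
    exists a, P A -> A a /\ forall f, G f -> f A <> a.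
  have [PA|nPA] := pselect (P A); last by exists t0.
  apply: contrapT => nex; apply: noA; exists A; split=> // a Aa.
  apply: contrapT => nf; apply: nex; exists a => _; split=> // f Gf fA.
  by apply: nf; exists f.
exfalso; apply: (Gmax (G `|` [set k])).
  split=> [f Gf|]; first by left.
  move=> /(_ k (or_intror erefl)) Gk.
  by have [_ /(_ _ Gk)] := kP _ PA0.
split.
  by move=> f [Gf|->] A PA; [exact: (Gsel _ Gf _ PA) | exact: (kP _ PA).1].
move=> f g [Gf|->] [Gg|->] A PA //; first exact: Ginj.
- by move=> fk; case: ((kP _ PA).2 _ Gf).
- by move=> kg; case: ((kP _ PA).2 _ Gg).
Qed.

Definition least_card (T : Type) (P : set (set T)) (P0 : P !=set0) : set T :=
  projT1 (cid (least_card_ex P0)).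

Lemma least_cardP (T : Type) (P : set (set T)) (P0 : P !=set0) :
  P (least_card P0) /\ forall B, P B -> least_card P0 #<= B.
Proof. exact: projT2 (cid (least_card_ex P0)). Qed.

Section PseudopavingNumber.
Variables (X : Type) (xi : convergence X).

Lemma pseudopavement_ex (x : X) : pseudopavement xi x !=set0.
Proof. by exists [set D | xi D x]; split=> // U _ Ux; exists U. Qed.

Definition pp_at (x : X) : set (pfilter_on X) :=
  least_card (pseudopavement_ex x).

Lemma pp_ub_ex : [set K : set (pfilter_on X) | forall x, pp_at x #<= K] !=set0.
Proof. by exists setT => x; apply: subset_card_le. Qed.

(* Since [setT] bounds every [pp_at x], looking for upper bounds among the sets
   of filters is enough to get the supremum of these cardinals. *)
Definition pp : set (pfilter_on X) := least_card pp_ub_ex.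

End PseudopavingNumber.

(* Main.v *)
(* Every filter of a pseudopavement at [x] converges to [x], so it does not mesh
   with a filter [G] not adhering to [x]; hence some element of [G] misses one of
   its elements.  When the pseudopavement is countable, these elements of [G]
   generate a countably based filter below [G], which meshes with no ultrafilter
   converging to [x]. *)
Require Import Defs.
From mathcomp Require Import all_boot.
From mathcomp Require Import boolp classical_sets functions cardinality filter.

Local Open Scope classical_set_scope.
Local Open Scope card_scope.

Lemma convergence_ext (X : Type) (xi tau : convergence X) :
  (forall F, xi F = tau F) -> xi = tau.
Proof.
case: xi tau => [l p m] [l' p' m'] /= /funext ll'; subst l'.
by congr Convergence; exact: Prop_irrelevance.
Qed.

Lemma not_meetsP (X : Type) (F G : set_system X) : ~ F `#` G ->
  exists A B, [/\ F A, G B & A `&` B = set0].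
Proof.
move=> nFG; apply: contrapT => nAB; apply: nFG => A B FA GB.
apply/set0P/eqP => AB0; apply: nAB.
by exists A, B.
Qed.

(** Meshing makes the sets [A] ∩ [B], with [A] in [F] and [B] in [G], a base of a proper filter,
    which extends to an ultrafilter. *)
Lemma meets_ultra (X : Type) (F G : pfilter_on X) : F `#` G ->
  exists U : pfilter_on X, [/\ UltraFilter U, F `<=` U & G `<=` U].
Proof.
move=> FG.
pose H := filter_from [set AB : set X * set X | F AB.1 /\ G AB.2]
  (fun AB => AB.1 `&` AB.2).
have HF : ProperFilter H.
  apply: filter_from_proper; last by move=> [A B] [/= FA GB]; exact: FG.
  apply: filter_from_filter; first by exists (setT, setT); split; exact: filterT.
  move=> [A B] [A' B'] [/= FA GB] [/= FA' GB'].
  exists (A `&` A', B `&` B'); first by split; exact: filterI.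
  by rewrite /= setIACA.
have [U [UU HU]] := ultraFilterLemma HF.
exists (PFilterPack U (@ultra_proper _ _ UU)); split=> //= A AF; apply: HU.
- by exists (A, setT); [split=> //; exact: filterT|rewrite /= setIT].
- by exists (setT, A); [split=> //; exact: filterT|rewrite /= setTI].
Qed.

(** Finite intersections of the [B n] stay in [G]; taken over initial segments, they decrease and so
    form a countable filter base. *)
Lemma countably_based_below (X : Type) (G : pfilter_on X) (B : nat -> set X) :
  (forall n, G (B n)) ->
  exists D : pfilter_on X,
    [/\ countably_based D, D `<=` G & forall n, D (B n)].
Proof.
move=> GB; pose C n := \bigcap_(k in `I_n) B k.
have GC n : G (C n).
  elim: n => [|n IHn].
    by apply: filterS filterT => x _ k.
  apply: filterS (filterI (GB n) IHn) => x [Bx Cx] k /=.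
  by rewrite ltnS leq_eqVlt => /predU1P[->//|]; exact: Cx.
have DG : filter_from (range C) id `<=` G.
  by move=> A [_ [n _ <-]] CA; exact: filterS CA (GC n).
have DF : Filter (filter_from (range C) id).
  apply: filter_from_filter; first by exists (C 0); exists 0.
  move=> _ _ [m _ <-] [n _ <-]; exists (C (maxn m n)); first by exists (maxn m n).
  move=> x Cx; split=> k kn; apply: Cx => /=; apply: leq_trans kn _.
    exact: leq_maxl.
  exact: leq_maxr.
have D0 : ~ filter_from (range C) id set0 by move/DG; exact: filter_not_empty.
exists (PFilterType (filter_from (range C) id) D0); split=> // [|n /=].
  exists (range C); split=> //.
  exact: card_image_le.
(* [C n] only involves indices below [n], so [C n.+1] is the first one inside [B n]. *)
by exists (C n.+1); [exists n.+1|move=> x; apply => /=].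
Qed.

Lemma cover_Lindelof_pseudopavement (X : Type) (xi : convergence X) (x : X)
    (DD : set (pfilter_on X)) :
  countable DD -> pseudopavement xi x DD -> cover_Lindelof xi x.
Proof.
move=> /countable_injP[f finj] [DDx DDU] G Gx.
(* [f] numbers the pseudopavement injectively, so each [n] is the code of at most one [D]; an [n]
   coding none gets [setT]. *)
have /choice[B GB] n : exists B, G B /\
    forall D, DD D -> f D = n -> exists2 A, D A & A `&` B = set0.
  have [[D [DDD fD]]|noD] := pselect (exists D, DD D /\ f D = n); last first.
    exists setT; split=> [|D DDD fD]; first exact: filterT.
    by case: noD; exists D.
  have /not_meetsP[A [B [DA GB AB]]] : ~ D `#` G.
    by move=> DG; apply: Gx; exists D => //; exact: DDx.
  exists B; split=> // D' DDD' fD'.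
  exists A => //; suff -> : D' = D by [].
  by apply: finj; rewrite ?inE// fD fD'.
have [D [Dcb DG DB]] := countably_based_below X G B (fun n => (GB n).1).
(* If [x] adhered to [D], an ultrafilter [U] finer than [D] would converge to [x], hence contain
   some [E] of the pseudopavement along with [B (f E)], which misses an element of [E]. *)
exists D; split=> // -[F /meets_ultra[U [UU FU DU]] Fx].
have [E DDE EU] := DDU U UU (clim_mono FU Fx).
have [A EA AB] := (GB (f E)).2 E DDE erefl.
apply: (filter_not_empty U); rewrite -AB.
by apply: filterI; [exact: EU|exact/DU/DB].
Qed.

Lemma cover_Lindelof_pp (X : Type) (xi : convergence X) :
  pp xi #<= [set: nat] -> forall x, cover_Lindelof xi x.
Proof.
move=> ppN x; apply: (@cover_Lindelof_pseudopavement _ _ _ (pp_at xi x)).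
  exact: card_le_trans ((least_cardP (pp_ub_ex xi)).1 x) ppN.
exact: (least_cardP (pseudopavement_ex xi x)).1.
Qed.

(** Only the inclusion of [S1_conv] limits in [S_conv] limits uses the hypothesis: a filter [D]
    meshing with [F] but not adhering to [x] could be replaced by a countably based [D'] below it,
    and a coarser filter still meshes with [F]. *)
Lemma cover_Lindelof_S1 (X : Type) (xi : convergence X) :
  (forall x, cover_Lindelof xi x) -> S_conv xi = S1_conv xi.
Proof.
move=> Lxi; apply: convergence_ext => F; apply/seteqP; split=> x Fx D [JD DF].
  exact: Fx.
apply: contrapT => /Lxi[D' [D'cb D'D]]; apply; apply: Fx; split=> // A B D'A.
by apply: DF; exact: D'D.
Qed.

Theorem theorem85 (X : Type) :
  [/\ forall xi : convergence X,
        (forall x, cover_Lindelof xi x) -> S_conv xi = S1_conv xi,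
      forall xi : convergence X,
        pp xi #<= [set: nat] -> forall x, cover_Lindelof xi x
    & forall xi : convergence X,
        pp xi #<= [set: nat] -> pseudotopology xi -> paratopology xi].
Proof.
split=> [xi|xi|xi ppN xiS]; [exact: cover_Lindelof_S1|exact: cover_Lindelof_pp|].
by rewrite /paratopology -cover_Lindelof_S1//; exact: cover_Lindelof_pp.
Qed.
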